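(* Let $G$ be a connected graph without isolated vertices. Then \[ \chi_d^t(G)\leq \gamma_t(G)+\min_S \chi(G[V(G)-S]), \] where the minimum is taken over all $\gamma_t(G)$-sets $S\subseteq V(G)$ (i.e., total dominating sets of $G$ of cardinality $\gamma_t(G)$). Moreover, this upper bound is sharp.
   Context: All graphs are finite, simple and undirected. A total dominating set of $G$ is a set $S\subseteq V(G)$ such that every vertex of $G$ has a neighbor in $S$; $\gamma_t(G)$ is the minimum cardinality of a total dominating set. $\chi(H)$ is the chromatic number of $H$, and $G[X]$ is the subgraph induced by $X$. A total dominator coloring of a graph $G$ is a proper vertex coloring of $G$ in which each vertex of $G$ is adjacent to every vertex of some color class (a color class is the set of all vertices receiving a given color). The total dominator chromatic number $\chi_d^t(G)$ is the minimum number of color classes in a total dominator coloring of $G$. *)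

(* Defs.v *)
From HB Require Import structures.
From mathcomp Require Import all_boot.

Set Implicit Arguments.
Unset Strict Implicit.
Unset Printing Implicit Defensive.

Record sgraph := SGraph {
  vertex :> finType;
  adj : rel vertex;
  adj_sym : symmetric adj;
  adj_irr : irreflexive adj }.

Section Induced.
Variables (G : sgraph) (X : {set G}).

Definition induced_adj : rel {x : G | x \in X} :=
  fun x y => adj (val x) (val y).

Lemma induced_adj_sym : symmetric induced_adj.
Proof. by move=> x y; rewrite /induced_adj adj_sym. Qed.

Lemma induced_adj_irr : irreflexive induced_adj.
Proof. by move=> x; rewrite /induced_adj adj_irr. Qed.

Definition induced : sgraph := SGraph induced_adj_sym induced_adj_irr.
End Induced.

Section GraphInvariants.
Variable G : sgraph.

Definition connected_graph : bool :=
  [forall x : G, forall y : G, connect (@adj G) x y].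

Definition no_isolated : bool := [forall x : G, exists y : G, adj x y].

Definition total_dominating (S : {set G}) : bool :=
  [forall x : G, exists y in S, adj x y].

(* In each minimum below the default value #|G| bounds every term from above,
   so it is only returned as a junk value when the index set is empty; see
   [bigminnP]. *)
Definition total_domination_number : nat :=
  \big[minn/#|G|]_(S : {set G} | total_dominating S) #|S|.

Definition min_total_dominating (S : {set G}) : bool :=
  total_dominating S && (#|S| == total_domination_number).

(* Colors are taken in the vertex type itself: a coloring of G has at most #|G|
   color classes, and only the classes matter. *)
Definition proper_coloring (f : {ffun G -> G}) : bool :=
  [forall x : G, forall y : G, adj x y ==> (f x != f y)].

(* Nonempty by construction, so that an unused color is not a color class. *)
Definition color_classes (f : {ffun G -> G}) : {set {set G}} :=
  [set [set y | f y == f x] | x : G].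

Definition chromatic_number : nat :=
  \big[minn/#|G|]_(f : {ffun G -> G} | proper_coloring f) #|color_classes f|.

Definition total_dominator_coloring (f : {ffun G -> G}) : bool :=
  proper_coloring f &&
  [forall x : G, exists C in color_classes f, forall y in C, adj x y].

Definition total_dominator_chromatic_number : nat :=
  \big[minn/#|G|]_(f : {ffun G -> G} | total_dominator_coloring f)
     #|color_classes f|.
End GraphInvariants.

Definition min_chromatic_compl (G : sgraph) : nat :=
  \big[minn/#|G|]_(S : {set G} | min_total_dominating S)
     chromatic_number (induced (~: S)).

Lemma bigminnP (I : finType) (P : pred I) (F : I -> nat) (d : nat) (i0 : I) :
    P i0 -> (forall i, P i -> F i <= d) ->
  exists2 i, P i & \big[minn/d]_(j | P j) F j = F i
                   /\ forall j, P j -> F i <= F j.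
Proof.
move=> Pi0 Fd; case: (arg_minnP F Pi0) => i Pi Fmin.
exists i => //; split=> //; apply/eqP; rewrite eqn_leq; apply/andP; split.
  have: i \in index_enum I by rewrite mem_index_enum.
  elim: (index_enum I) => // a s IHs; rewrite inE big_cons => /orP[/eqP <- | si].
    by rewrite Pi geq_minl.
  by case: ifP => _; rewrite ?geq_min IHs ?orbT.
elim/big_ind: _ => [|x y Hx Hy|j /Fmin//]; first exact: Fd.
by rewrite leq_min Hx.
Qed.

Lemma card_color_classes (G : sgraph) (f : {ffun G -> G}) :
  #|color_classes f| <= #|G|.
Proof. exact: leq_imset_card. Qed.

Lemma total_dominating_setT (G : sgraph) :
  no_isolated G -> total_dominating [set: G].
Proof.
move=> /forallP h; apply/forallP => x; have /existsP[y xy] := h x.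
by apply/existsP; exists y; rewrite inE.
Qed.

Lemma total_dominator_coloring_id (G : sgraph) :
  no_isolated G -> total_dominator_coloring [ffun x : G => x].
Proof.
move=> /forallP h; apply/andP; split.
  apply/forallP => x; apply/forallP => y; apply/implyP => xy; rewrite !ffunE.
  by apply: contraTneq xy => ->; rewrite adj_irr.
apply/forallP => x; have /existsP[y xy] := h x.
apply/existsP; exists [set z | [ffun z => z] z == [ffun z : G => z] y].
rewrite imset_f //=; apply/forallP => z.
by rewrite inE !ffunE; apply/implyP => /eqP->.
Qed.

(* Main.v *)
(* Take a minimum total dominating set S realizing the minimum and an optimal
   coloring of G - S.  Giving each vertex of S a private color makes {s} a color
   class for every s in S, so any neighbor of x in S yields a class to which x is
   completely adjacent.

   Sharpness: the right-hand side never exceeds |V(G)|, because chi(G - S) is at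
   most |V(G)| - |S|, while a complete graph needs |V(G)| colors. *)
Require Import Defs.
From HB Require Import structures.
From mathcomp Require Import all_boot.

Set Implicit Arguments.
Unset Strict Implicit.
Unset Printing Implicit Defensive.

Lemma bigminn_le (I : finType) (P : pred I) (F : I -> nat) (d : nat) (j : I) :
    P j -> (forall i, P i -> F i <= d) ->
  \big[minn/d]_(i | P i) F i <= F j.
Proof. by move=> Pj Fd; have [i _ [-> ]] := bigminnP Pj Fd; apply. Qed.

(** A fiber over a color in use is nonempty, so it determines that color. Color classes can thus be
    counted as colors in the image of [f]. *)
Lemma card_color_classesE (G : sgraph) (f : {ffun G -> G}) :
  #|color_classes f| = #|f @: [set: G]|.
Proof.
pose h c := [set y | f y == c].
have -> : color_classes f = h @: (f @: [set: G]).
  apply/setP => C; apply/imsetP/imsetP => [[x _ ->]|[_ /imsetP[x _ ->] ->]].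
    by exists (f x); rewrite ?imset_f.
  by exists x.
apply: card_in_imset => _ _ /imsetP[x _ ->] /imsetP[y _ ->] /setP/(_ x).
by rewrite !inE eqxx => /esym/eqP.
Qed.

Lemma proper_coloring_id (G : sgraph) : proper_coloring [ffun x : G => x].
Proof.
apply/forallP => x; apply/forallP => y; apply/implyP; rewrite !ffunE.
by apply: contraTneq => ->; rewrite adj_irr.
Qed.

Lemma chromatic_number_attained (G : sgraph) :
  exists2 f : {ffun G -> G},
    proper_coloring f & chromatic_number G = #|color_classes f|.
Proof.
have [f fP [e _]] := bigminnP (proper_coloring_id G)
  (fun f _ => card_color_classes f).
by exists f.
Qed.

Lemma chromatic_number_le_card (G : sgraph) : chromatic_number G <= #|G|.
Proof.
by have [f _ ->] := chromatic_number_attained G; apply: card_color_classes.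
Qed.

Lemma chromatic_induced_le (G : sgraph) (X : {set G}) :
  chromatic_number (induced X) <= #|X|.
Proof.
by apply: leq_trans (chromatic_number_le_card _) _; rewrite card_sig.
Qed.

Lemma min_total_dominating_exists (G : sgraph) :
  no_isolated G -> exists S : {set G}, min_total_dominating S.
Proof.
move=> /total_dominating_setT domT.
have [S domS [e _]] := bigminnP domT (fun (A : {set G}) _ => max_card (mem A)).
by exists S; rewrite /min_total_dominating domS /total_domination_number e eqxx.
Qed.

Lemma min_chromatic_compl_attained (G : sgraph) :
    no_isolated G ->
  exists2 S : {set G}, min_total_dominating S &
    min_chromatic_compl G = chromatic_number (induced (~: S)).
Proof.
move=> /min_total_dominating_exists[S0 minS0].
(* [bigminnP] yields a minimizing set only once the default value [#|G|] is known to bound every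
   term. *)
have bound (S : {set G}) : min_total_dominating S ->
    chromatic_number (induced (~: S)) <= #|G|.
  by move=> _; apply: leq_trans (chromatic_induced_le _) (max_card _).
by have [S minS [e _]] := bigminnP minS0 bound; exists S.
Qed.

Section ColoringExtension.
Variables (G : sgraph) (S : {set G}).
Variable f : {ffun induced (~: S) -> induced (~: S)}.

(** Colors are themselves vertices: a vertex of [S] is its own color, and any other vertex keeps its
    color under [f], which is a vertex outside [S]. The two kinds of colors are therefore
    disjoint. *)
Definition extend_coloring : {ffun G -> G} :=
  [ffun x => if insub x is Some y then val (f y) else x].

Lemma extend_coloring_in x : x \in S -> extend_coloring x = x.
Proof. by move=> xS; rewrite ffunE insubN // inE xS. Qed.

Lemma extend_coloring_out (y : induced (~: S)) :
  extend_coloring (val y) = val (f y).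
Proof. by rewrite ffunE valK. Qed.

(** Colors inherited from [f] lie outside [S], and distinct vertices of [S] have distinct colors. So
    the class of [s] is the singleton of [s]. *)
Lemma extend_coloring_class s x :
  s \in S -> (extend_coloring x == extend_coloring s) = (x == s).
Proof.
move=> sS; rewrite (extend_coloring_in sS).
have [xS|xS] := boolP (x \in S); first by rewrite extend_coloring_in.
have xC : x \in ~: S by rewrite inE.
rewrite -[x](SubK {x | x \in ~: S} xC) extend_coloring_out.
have outS (y : induced (~: S)) : (val y == s) = false.
  by apply: contraTF sS => /eqP <-; have := valP y; rewrite inE.
by rewrite !outS.
Qed.

Lemma extend_coloring_proper :
  proper_coloring f -> proper_coloring extend_coloring.
Proof.
move=> fP; apply/forallP => x; apply/forallP => y; apply/implyP => xy.
have neq_xy : x != y by apply: contraTneq xy => ->; rewrite adj_irr.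
have [xS|xS] := boolP (x \in S).
  by rewrite eq_sym extend_coloring_class // eq_sym.
have [yS|yS] := boolP (y \in S); first by rewrite extend_coloring_class.
have xC : x \in ~: S by rewrite inE.
have yC : y \in ~: S by rewrite inE.
pose u : induced (~: S) := Sub x xC; pose v : induced (~: S) := Sub y yC.
rewrite (extend_coloring_out u) (extend_coloring_out v).
(* Both ends lie outside [S], so the edge is an edge of the induced subgraph and properness of [f]
   applies. *)
rewrite (inj_eq val_inj).
by have /forallP/(_ u)/forallP/(_ v)/implyP := fP; apply.
Qed.

Lemma extend_coloring_dominator :
    total_dominating S -> proper_coloring f ->
  total_dominator_coloring extend_coloring.
Proof.
move=> /forallP domS fP.
rewrite /total_dominator_coloring extend_coloring_proper //=.
apply/forallP => x; have /exists_inP[s sS xs] := domS x.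
(* The chosen class is just the singleton of [s], so complete adjacency to it reduces to [xs]. *)
apply/exists_inP; exists [set y | extend_coloring y == extend_coloring s].
  exact: imset_f.
by apply/forall_inP => y; rewrite inE extend_coloring_class // => /eqP->.
Qed.

(** Every color used lies in [S] or in the copy in [G] of the image of [f]; [val] is injective, so
    that copy has as many elements as [f] has classes. *)
Lemma card_extend_coloring :
  #|color_classes extend_coloring| <= #|S| + #|color_classes f|.
Proof.
rewrite !card_color_classesE -(card_imset _ (@val_inj _ _ {x | x \in ~: S})).
apply: leq_trans (leq_card_setU _ _); apply: subset_leq_card.
apply/subsetP => _ /imsetP[x _ ->]; rewrite inE.
have [xS|xS] := boolP (x \in S); first by rewrite extend_coloring_in ?xS.
have xC : x \in ~: S by rewrite inE.
rewrite (extend_coloring_out (Sub x xC : {x | x \in ~: S})).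
by rewrite !imset_f ?orbT ?inE.
Qed.
End ColoringExtension.

Lemma total_dominator_chromatic_number_le (G : sgraph) :
    no_isolated G ->
  total_dominator_chromatic_number G
    <= total_domination_number G + min_chromatic_compl G.
Proof.
move=> /min_chromatic_compl_attained[S /andP[domS /eqP<-] ->].
have [f fP ->] := chromatic_number_attained (induced (~: S)).
apply: leq_trans (card_extend_coloring f).
apply: bigminn_le (extend_coloring_dominator domS fP) _ => g _.
exact: card_color_classes.
Qed.

Lemma domination_chromatic_le_card (G : sgraph) :
  no_isolated G -> total_domination_number G + min_chromatic_compl G <= #|G|.
Proof.
move=> /min_chromatic_compl_attained[S /andP[_ /eqP<-] ->].
by rewrite -(cardsC S) leq_add2l chromatic_induced_le.
Qed.

Section CompleteGraph.
Variable T : finType.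

Definition complete_adj : rel T := fun x y => x != y.

Lemma complete_adj_sym : symmetric complete_adj.
Proof. by move=> x y; rewrite /complete_adj eq_sym. Qed.

Lemma complete_adj_irr : irreflexive complete_adj.
Proof. by move=> x; rewrite /complete_adj eqxx. Qed.

Definition complete_graph : sgraph := SGraph complete_adj_sym complete_adj_irr.

Lemma complete_connected : connected_graph complete_graph.
Proof.
apply/forallP => x; apply/forallP => y.
by have [->|neq_xy] := eqVneq x y; [apply: connect0 | apply: connect1].
Qed.

Lemma complete_no_isolated : 1 < #|T| -> no_isolated complete_graph.
Proof.
move=> T_gt1; apply/forallP => x; apply/existsP.
have : 0 < #|predC1 x| by rewrite cardC1; case: #|T| T_gt1 => [|[]].
case/card_gt0P => y; rewrite inE => neq_yx.
by exists y; rewrite /= /complete_adj eq_sym.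
Qed.

(** On a complete graph, properness is injectivity. *)
Lemma complete_proper_card (f : {ffun complete_graph -> complete_graph}) :
  proper_coloring f -> #|color_classes f| = #|T|.
Proof.
move=> /forallP fP; rewrite card_color_classesE card_imset ?cardsT // => x y.
apply: contra_eq => neq_xy.
by have /forallP/(_ y)/implyP := fP x; apply.
Qed.

Lemma complete_total_dominator_chromatic_number :
  1 < #|T| -> total_dominator_chromatic_number complete_graph = #|T|.
Proof.
move=> /complete_no_isolated/total_dominator_coloring_id tdc.
(* The identity coloring [tdc] ensures that the minimum is attained by some proper coloring. *)
have [f /andP[fP _] [e _]] := bigminnP tdc (fun f _ => card_color_classes f).
by rewrite /total_dominator_chromatic_number e complete_proper_card.
Qed.
End CompleteGraph.

Theorem theorem3p6 :
  (forall G : sgraph, connected_graph G -> no_isolated G ->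
     total_dominator_chromatic_number G
       <= total_domination_number G + min_chromatic_compl G)
  /\
  (forall n : nat, exists G : sgraph,
     [/\ connected_graph G, no_isolated G, n <= #|G| &
         total_dominator_chromatic_number G
           = total_domination_number G + min_chromatic_compl G]).
Proof.
split=> [G _|n]; first exact: total_dominator_chromatic_number_le.
(* Two extra vertices rule out isolated vertices even for [n = 0], and give examples of arbitrarily
   large order. *)
pose T : finType := 'I_n.+2; have T_gt1 : 1 < #|T| by rewrite card_ord.
have noiso := complete_no_isolated T_gt1.
exists (complete_graph T); split=> //; first exact: complete_connected.
  by rewrite card_ord -addn2 leq_addr.
(* Sandwich: the upper bound gives one inequality, and the right-hand side is at most [#|T|], the
   value of the left-hand side. *)
apply/eqP; rewrite eqn_leq total_dominator_chromatic_number_le //=.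
rewrite complete_total_dominator_chromatic_number //.
exact: domination_chromatic_le_card.
Qed.
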